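(* Let $\mathcal{A}$ be a field of subsets of a nonempty set $X$, with $\mathcal{M}(X,\mathcal{A})$ regarded as a ring under pointwise operations (standing assumption: it is closed under pointwise addition and multiplication). Then the space $\operatorname{Max}(\mathcal{M}(X,\mathcal{A}))$ is homeomorphic to the Stone space $\operatorname{Spec}(\mathcal{A})$.
   Context: A field of subsets of a nonempty set $X$ is a nonempty family $\mathcal{A}\subseteq\mathcal{P}(X)$ closed under finite unions and complements in $X$; it is a Boolean algebra under the set operations. $\mathcal{M}(X,\mathcal{A})=\{f:X\to\mathbb{R} : f^{-1}(U)\in\mathcal{A}\text{ for every open }U\subseteq\mathbb{R}\}$, with pointwise operations. For a commutative ring $R$ with identity, $\operatorname{Max}(R)$ is the set of maximal ideals of $R$ with the hull-kernel topology, whose basic open sets are $\mathbb{D}(a)=\{\mathfrak{m}\in\operatorname{Max}(R): a\notin\mathfrak{m}\}$, $a\in R$. For a Boolean algebra $\mathbb{B}$, an order ideal is a nonempty subset that is downward closed and closed under finite joins; it is proper if it does not contain $1$; a proper order ideal $P$ is prime if for every $b\in\mathbb{B}$ either $b\in P$ or $b'\in P$. $\operatorname{Spec}(\mathbb{B})$ is the set of all prime ideals of $\mathbb{B}$ with the Stone topology, whose basic open sets are $\mathcal{U}(a)=\{P\in\operatorname{Spec}(\mathbb{B}): a\notin P\}$, $a\in\mathbb{B}$. *)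

(* Defs.v *)
From HB Require Import structures.
From mathcomp Require Import all_boot all_order all_algebra.
From mathcomp Require Import all_classical all_reals all_analysis.
Import Order.CTheory Order.TTheory GRing.Theory Num.Theory.
Import numFieldNormedType.Exports.

Set Implicit Arguments.
Unset Strict Implicit.
Unset Printing Implicit Defensive.

Local Open Scope classical_set_scope.
Local Open Scope ring_scope.

Definition homeomorphic (S T : topologicalType) : Prop :=
  exists (f : S -> T) (g : T -> S),
    [/\ continuous f, continuous g, cancel f g & cancel g f].

Section MaxSpectrum.
Variable S : comPzRingType.
Implicit Types (I J : set S) (a : S).

(* [idealr_closed] of ring_quotient is restricted to nonzero rings and
   bundles properness. *)
Definition ring_ideal I : Prop :=
  [/\ I 0, forall a b, I a -> I b -> I (a + b) & forall a b, I b -> I (a * b)].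

Definition maximal_ideal I : Prop :=
  [/\ ring_ideal I, I <> setT &
      forall J, ring_ideal J -> I `<=` J -> J = I \/ J = setT].

Lemma maximal_ideal_prime I a b :
  maximal_ideal I -> I (a * b) -> I a \/ I b.
Proof.
move=> [[I0 ID IM] _ Imax] Iab; apply: contrapT => /not_orP[nIa nIb].
pose J := [set x | exists i r, I i /\ x = i + r * a].
have IJ : I `<=` J by move=> i Ii; exists i, 0; rewrite mul0r addr0.
have Ja : J a by exists 0, 1; rewrite mul1r add0r.
have Jid : ring_ideal J.
  split; first exact: IJ.
    move=> _ _ [i [r [Ii ->]]] [j [s [Ij ->]]]; exists (i + j), (r + s).
    by split; [exact: ID|rewrite mulrDl addrACA].
  move=> c _ [i [r [Ii ->]]]; exists (c * i), (c * r).
  by split; [exact: IM|rewrite mulrDr mulrA].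
have [JI|JT] := Imax J Jid IJ; first by apply: nIa; rewrite -JI.
have [i [r [Ii e]]] : J 1 by rewrite JT.
apply: nIb; rewrite -(mulr1 b) e mulrDr; apply: ID; first exact: IM.
by rewrite mulrCA (mulrC b); exact: IM.
Qed.

Record Max := MkMax { Max_set :> set S; Max_maximal : maximal_ideal Max_set }.

HB.instance Definition _ := gen_eqMixin Max.
HB.instance Definition _ := gen_choiceMixin Max.

Definition hull_basic a : set Max := [set m | ~ Max_set m a].

Lemma hull_basic_cover :
  \bigcup_(U in range hull_basic) U = [set: Max].
Proof.
apply/seteqP; split=> // m _; exists (hull_basic 1); first by exists 1.
move=> m1; have [[_ _ IM] IT _] := Max_maximal m; apply: IT.
by apply/seteqP; split=> // a _; rewrite -(mulr1 a); exact: IM.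
Qed.

Lemma hull_basic_join (U V : set Max) m :
  range hull_basic U -> range hull_basic V -> U m -> V m ->
  exists W, [/\ range hull_basic W, W m & W `<=` U `&` V].
Proof.
move=> [a _ <-] [b _ <-] ma mb; exists (hull_basic (a * b)).
split; first by exists (a * b).
  by move=> /(maximal_ideal_prime (Max_maximal m))[].
move=> n nab; have [[_ _ IM] _ _] := Max_maximal n.
by split=> nc; apply: nab; [rewrite mulrC|]; exact: IM.
Qed.

(* the indices of the base are the basic open sets themselves *)
HB.instance Definition _ :=
  isBaseTopological.Build Max hull_basic_cover hull_basic_join.

End MaxSpectrum.

Section StoneSpace.
Variables (d : Order.disp_t) (B : ctbDistrLatticeType d).
Implicit Types (P : set B) (a b : B).

Definition order_ideal P : Prop :=
  [/\ P !=set0,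
      forall a b, (a <= b)%O -> P b -> P a &
      forall a b, P a -> P b -> P (Order.join a b)].

Definition prime_ideal P : Prop :=
  [/\ order_ideal P, ~ P (Order.top : B) & forall b, P b \/ P (Order.compl b)].

Lemma prime_ideal_meet P a b :
  prime_ideal P -> P (Order.meet a b) -> P a \/ P b.
Proof.
move=> [[_ Ple PU] _ Pc] Pab; have [Pa|Pca] := Pc a; [by left|right].
apply: (Ple b (Order.join (Order.meet a b) (Order.compl a))); last exact: PU.
by rewrite joinIl joinxC meet1x leUl.
Qed.

Record Spec := MkSpec { Spec_set :> set B; Spec_prime : prime_ideal Spec_set }.

HB.instance Definition _ := gen_eqMixin Spec.
HB.instance Definition _ := gen_choiceMixin Spec.

Definition stone_basic a : set Spec := [set P | ~ Spec_set P a].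

Lemma stone_basic_cover :
  \bigcup_(U in range stone_basic) U = [set: Spec].
Proof.
apply/seteqP; split=> // P _; exists (stone_basic Order.top).
  by exists Order.top.
by have [] := Spec_prime P.
Qed.

Lemma stone_basic_join (U V : set Spec) (P : Spec) :
  range stone_basic U -> range stone_basic V -> U P -> V P ->
  exists W, [/\ range stone_basic W, W P & W `<=` U `&` V].
Proof.
move=> [a _ <-] [b _ <-] Pa Pb; exists (stone_basic (Order.meet a b)).
split; first by exists (Order.meet a b).
  by move=> /(prime_ideal_meet (Spec_prime P))[].
move=> Q Qab; have [[_ Qle _] _ _] := Spec_prime Q.
by split=> Qc; apply: Qab; apply: Qle Qc; rewrite ?leIl ?leIr.
Qed.

HB.instance Definition _ :=
  isBaseTopological.Build Spec stone_basic_cover stone_basic_join.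

End StoneSpace.

Definition field_of_sets (X : Type) (A : set (set X)) : Prop :=
  [/\ A !=set0, setU_closed A & setC_closed A].

Section FieldOfSets.
Variables (X : Type) (A : set (set X)) (hA : field_of_sets A).

Lemma field_of_setsI : setI_closed A.
Proof.
case: hA => _ UA CA U V UA' AV; rewrite -(setCK (U `&` V)) setCI.
by apply: (CA); apply: UA; exact: CA.
Qed.

Lemma field_of_setsT : A setT.
Proof. by case: hA => -[U UA'] UA CA; rewrite -(setUv U); exact/UA/CA. Qed.

Lemma field_of_sets0 : A set0.
Proof. by case: hA => _ _ CA; rewrite -setCT; exact/CA/field_of_setsT. Qed.

(* the members of A, as a Boolean algebra under the set operations; the proof
   hA is a parameter so that the instances below can depend on it *)
Definition set_alg of field_of_sets A : Type := {U : set X | U \in A}.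
Local Notation T := (set_alg hA).

HB.instance Definition _ := Choice.on T.
HB.instance Definition _ := SubType.on T.

Let algI : meet_closed (mem A).
Proof. by move=> U V; rewrite !inE; exact: field_of_setsI. Qed.

Let algU : join_closed (mem A).
Proof. by move=> U V; rewrite !inE; case: hA => _ + _; exact. Qed.

Let alg0 : (Order.bottom : set X) \in mem A.
Proof. by rewrite inE; exact: field_of_sets0. Qed.

Let algT : (Order.top : set X) \in mem A.
Proof. by rewrite inE; exact: field_of_setsT. Qed.

HB.instance Definition _ :=
  Order.SubChoice_isTBSubLattice.Build _ _ _ set_display T algI algU alg0 algT.

Let algIUl : @left_distributive T T Order.meet Order.join.
Proof. by move=> U V W; apply: val_inj; exact: setIUl. Qed.

HB.instance Definition _ :=
  Order.Lattice_Meet_isDistrLattice.Build set_display T algIUl.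

Let algC (U : T) : ~` (val U) \in A.
Proof. by rewrite inE; case: hA => _ _; apply; exact: set_mem (valP U). Qed.

Definition alg_compl (U : T) : T := exist _ (~` (val U)) (algC U).

Let alg_joinC (U : T) : Order.join U (alg_compl U) = Order.top.
Proof. by apply: val_inj; exact: setUv. Qed.

Let alg_meetC (U : T) : Order.meet U (alg_compl U) = Order.bottom.
Proof. by apply: val_inj; exact: setICr. Qed.

HB.instance Definition _ := Order.TBDistrLattice_hasComplement.Build
  set_display T alg_joinC alg_meetC.

End FieldOfSets.

Section MeasurableFunctions.
Variables (R : realType) (X : Type) (A : set (set X)).

Definition meas_fun : set (X -> R) :=
  [set f | forall U : set R, open U -> A (f @^-1` U)].

Definition meas_addr_closed : Prop :=
  forall f g, meas_fun f -> meas_fun g -> meas_fun (f \+ g).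

Definition meas_mulr_closed : Prop :=
  forall f g, meas_fun f -> meas_fun g -> meas_fun (f \* g).

Hypotheses (hA : field_of_sets A).
Hypotheses (hD : meas_addr_closed) (hM : meas_mulr_closed).

Definition meas_ring of
  field_of_sets A & meas_addr_closed & meas_mulr_closed : Type :=
  {f : X -> R | f \in meas_fun}.
Local Notation T := (meas_ring hA hD hM).

HB.instance Definition _ := Choice.on T.
HB.instance Definition _ := SubType.on T.

Lemma meas_fun_cst (c : R) : meas_fun (cst c).
Proof.
move=> U _; rewrite preimage_cst.
by case: ifP => _; [exact: field_of_setsT|exact: field_of_sets0].
Qed.

Let meas_subring : subring_closed (mem meas_fun).
Proof.
split=> [|f g|f g]; rewrite !inE; first exact: meas_fun_cst.
  move=> Mf Mg; have -> : f - g = f \+ (cst (-1) \* g).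
    by apply/funext => x /=; rewrite mulN1r.
  by apply: hD => //; apply: hM => //; exact: meas_fun_cst.
exact: hM.
Qed.

HB.instance Definition _ :=
  GRing.SubChoice_isSubComPzRing.Build (X -> R) _ T meas_subring.

End MeasurableFunctions.

(* Main.v *)
Require Import Defs.
From mathcomp Require Import all_boot all_order all_algebra.
From mathcomp Require Import all_classical all_reals all_analysis.
Import Order.CTheory Order.TTheory GRing.Theory Num.Theory.
Import numFieldNormedType.Exports.

(** Write M for the ring of A-measurable functions and chi_U for the indicator
of U in A.  The ring M is von Neumann regular: extended by 0^-1 = 0, inversion
is a measurable operation, so every f in M has a quasi-inverse f* in M, with
f * f* = chi_(coz f), where coz f = {f <> 0} is a member of A.  Together with
f * chi_(coz f) = f this says that f and the idempotent chi_(coz f) generate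
the same ideal ([mulr_qinv], [mulr_char_coz]).  Hence an ideal of M is
determined by the idempotents it contains, that is, by a set of members of A.

Concretely, a maximal ideal m is sent to the prime ideal {U | chi_U in m} of
the Boolean algebra A, and a prime ideal P of A to the maximal ideal
{f | coz f in P} of M.  That these are mutually inverse is the generation
statement above in one direction and coz chi_U = U in the other.  They exchange
basic open sets: the preimage of U(U) is D(chi_U), and the preimage of D(f) is
U(coz f), so both maps are continuous. *)

Set Implicit Arguments.
Unset Strict Implicit.
Unset Printing Implicit Defensive.

Local Open Scope classical_set_scope.

(** * Basic open sets of the two spectra *)

Section BasicOpenSets.

Lemma open_hull_basic (S : comPzRingType) (a : S) : open (hull_basic a).
Proof.
by exists [set hull_basic a]; [move=> _ ->; exists a|rewrite bigcup_set1].
Qed.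

Lemma open_stone_basic (d : Order.disp_t) (B : ctbDistrLatticeType d) (a : B) :
  open (stone_basic a).
Proof.
by exists [set stone_basic a]; [move=> _ ->; exists a|rewrite bigcup_set1].
Qed.

Lemma continuous_to_Max (T : topologicalType) (S : comPzRingType)
    (f : T -> Max S) :
  (forall a, open (f @^-1` hull_basic a)) -> continuous f.
Proof.
move=> fo; apply/continuousP => _ [D sD <-]; rewrite preimage_bigcup.
by apply: bigcup_open => U /sD[a _ <-]; exact: fo.
Qed.

Lemma continuous_to_Spec (T : topologicalType) (d : Order.disp_t)
    (B : ctbDistrLatticeType d) (f : T -> Spec B) :
  (forall a, open (f @^-1` stone_basic a)) -> continuous f.
Proof.
move=> fo; apply/continuousP => _ [D sD <-]; rewrite preimage_bigcup.
by apply: bigcup_open => U /sD[a _ <-]; exact: fo.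
Qed.

Lemma Max_inj (S : comPzRingType) : injective (@Max_set S).
Proof.
move=> [I hI] [J hJ] /= IJ; subst J.
by congr MkMax; exact: Prop_irrelevance.
Qed.

Lemma Spec_inj (d : Order.disp_t) (B : ctbDistrLatticeType d) :
  injective (@Spec_set d B).
Proof.
move=> [P hP] [Q hQ] /= PQ; subst Q.
by congr MkSpec; exact: Prop_irrelevance.
Qed.

End BasicOpenSets.

Local Open Scope ring_scope.

(** * Measurability of cozero sets, inverses and indicators *)

Section MeasurableFunctionTheory.
Context (R : realType) (X : Type) (A : set (set X)) (hA : field_of_sets A).

(** Inversion is discontinuous only at 0, so removing that point from the
preimage of an open set leaves an open set. *)
Lemma open_preimage_inv (U : set R) :
  open U -> open [set x : R | x != 0 /\ U x^-1].
Proof.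
move=> oU; rewrite openE => x [x0 Ux].
have Uinv : \forall y \near x, U y^-1.
  by apply: (inv_continuous x0); exact: open_nbhs_nbhs.
have neq0 : \forall y \near x, y != 0.
  by apply: open_nbhs_nbhs; split => //; exact: open_neq.
by move: Uinv neq0; apply: filterS2.
Qed.

Lemma meas_fun_neq0 (f : X -> R) : meas_fun A f -> A [set x | f x != 0].
Proof. by move=> Mf; apply: (Mf [set y | y != 0]); exact: open_neq. Qed.

(** With the convention 0^-1 = 0, the point 0 removed in [open_preimage_inv]
contributes either the zero set of f or nothing.  A field of sets contains the
zero set, being the complement of the preimage of an open set. *)
Lemma meas_fun_inv (f : X -> R) :
  meas_fun A f -> meas_fun A (fun x => (f x)^-1).
Proof.
move=> Mf U oU.
have [_ AU AC] := hA.
have -> : (fun x => (f x)^-1) @^-1` U =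
    (f @^-1` [set y | y != 0 /\ U y^-1]) `|`
    (~` [set x | f x != 0] `&` [set x | U 0]).
  apply/seteqP; split=> x /=.
    have [->|fx0 Ufx] := eqVneq (f x) 0; rewrite ?invr0.
      by move=> U0; right; split=> //; apply/negP; rewrite negbK.
    by left.
  by case=> -[] // /negP; rewrite negbK => /eqP ->; rewrite invr0.
apply: AU; first exact/Mf/open_preimage_inv.
apply: (field_of_setsI hA); first exact/AC/meas_fun_neq0.
(* The set [set x | U 0] is the preimage of U under the zero function. *)
exact: (meas_fun_cst hA 0 oU).
Qed.

Lemma meas_fun_indic (U : set X) : A U -> meas_fun A (\1_U : X -> R).
Proof.
move=> AU V _; rewrite preimage_indic.
have [_ _ AC] := hA.
by do 2! case: ifP => _; [exact: field_of_setsT|exact: AU|exact: AC|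
  exact: field_of_sets0].
Qed.

End MeasurableFunctionTheory.

(** * Cozero sets and idempotents *)

Section MaxSpec.
Context (R : realType) (X : Type) (A : set (set X)) (hA : field_of_sets A).
Context (hD : meas_addr_closed R A) (hM : meas_mulr_closed R A).
Local Notation M := (meas_ring hA hD hM).
Local Notation B := (set_alg hA).
Implicit Types (f g : M) (U V : B).

Definition coz f : B :=
  exist _ [set x | val f x != 0] (mem_set (meas_fun_neq0 (set_mem (valP f)))).

Definition char U : M :=
  exist _ (\1_(val U)) (mem_set (meas_fun_indic hA (set_mem (valP U)))).

(** The quasi-inverse witnessing that the ring is von Neumann regular:
f * qinv f * f = f. *)
Definition qinv f : M :=
  exist _ (fun x => (val f x)^-1) (mem_set (meas_fun_inv hA (set_mem (valP f)))).

Lemma coz_char U : coz (char U) = U.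
Proof.
apply: val_inj; apply/seteqP; split=> x /=; rewrite indicE.
  by case: (boolP (x \in _)) => [/set_mem//|_]; rewrite eqxx.
by move=> /mem_set ->; exact: oner_neq0.
Qed.

Lemma mulr_qinv f : f * qinv f = char (coz f).
Proof.
apply: val_inj; apply/funext => x; rewrite /= indicE.
change (val f x * (val f x)^-1 = (x \in [set x | val f x != 0])%:R).
have [fx0|fx0] := eqVneq (val f x) 0; last by rewrite divff // mem_set.
by rewrite fx0 mul0r memNset //; apply/negP; rewrite negbK; apply/eqP.
Qed.

(** By this and [mulr_qinv], f and the indicator of its cozero set divide each
other, hence lie in the same ideals. *)
Lemma mulr_char_coz f : f * char (coz f) = f.
Proof.
apply: val_inj; apply/funext => x; rewrite /=.
change (val f x * \1_[set x | val f x != 0] x = val f x); rewrite indicE.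
have [->|fx0] := eqVneq (val f x) 0; first by rewrite mul0r.
by rewrite mem_set // mulr1.
Qed.

Lemma charI U V : char (Order.meet U V) = char U * char V.
Proof. by apply: val_inj; exact: indicI. Qed.

Lemma charT : char Order.top = 1.
Proof. by apply: val_inj; exact: indicT. Qed.

Lemma char0 : char Order.bottom = 0.
Proof. by apply: val_inj; exact: indic0. Qed.

Lemma charC U : char U + char (Order.compl U) = 1.
Proof.
apply: val_inj; apply/funext => x /=.
change (\1_(val U) x + \1_(~` val U) x = 1 :> R); rewrite !indicE in_setC.
by case: (x \in _); rewrite ?addr0 ?add0r.
Qed.

Lemma coz0 : coz 0 = Order.bottom.
Proof. by apply: val_inj; apply/seteqP; split=> x //= /eqP. Qed.

(** The values lie in an integral domain, so a product is nonzero exactly where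
both factors are. *)
Lemma cozM f g : coz (f * g) = Order.meet (coz f) (coz g).
Proof.
apply: val_inj; apply/seteqP; split=> x /=.
  change (val f x * val g x != 0 -> val f x != 0 /\ val g x != 0).
  by rewrite mulf_eq0 negb_or => /andP.
change (val f x != 0 /\ val g x != 0 -> val f x * val g x != 0).
by case=> fx gx; rewrite mulf_neq0.
Qed.

Lemma cozD f g : (coz (f + g) <= Order.join (coz f) (coz g))%O.
Proof.
rewrite leEmeet; apply/eqP/val_inj/seteqP; split=> x /=; first by case.
change (val f x + val g x != 0 ->
  val f x + val g x != 0 /\ (val f x != 0 \/ val g x != 0)).
move=> fg; split=> //.
have [f0|] := eqVneq (val f x) 0; [right|by left].
by move: fg; rewrite f0 add0r.
Qed.

(** * The correspondence between maximal ideals and prime ideals *)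

(** Each axiom of a prime ideal of sets mirrors a ring identity: chi_U is a
multiple of chi_V when U is contained in V, the indicator of a union is
chi_U + chi_V (1 - chi_U), and primality comes from chi_U chi_(U') = 0 because
maximal ideals are prime. *)
Lemma stone_of_max_prime (m : Max M) : prime_ideal [set U | Max_set m (char U)].
Proof.
have [[m0 mD mM] mT _] := Max_maximal m.
have mle U V : (U <= V)%O -> Max_set m (char V) -> Max_set m (char U).
  by rewrite leEmeet => /eqP <- mV; rewrite charI; exact: mM.
split; first split.
- by exists Order.bottom => /=; rewrite char0.
- exact: mle.
- move=> U V /= mU mV.
  (* Splitting the union along U and its complement bounds the two pieces by U
     and by V. *)
  rewrite -[char _]mulr1 -(charC U) mulrDr -!charI.
  apply: mD; first by apply: mle mU; rewrite leIr.
  apply: mle mV; rewrite meetUl meetxC join0x; exact: leIl.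
- rewrite /= charT => m1; apply: mT; apply/seteqP; split=> // f _.
  by rewrite -[f]mulr1; exact: mM.
- move=> U; apply: (maximal_ideal_prime (Max_maximal m)).
  by rewrite -charI meetxC char0.
Qed.

(** Maximality: if an ideal J above {f | coz f in P} contains some f with
coz f outside P, then the indicator of coz f is in J as a multiple of f, and
that of the complement is in J because P is prime; they add up to 1. *)
Lemma max_of_stone_maximal (P : Spec B) :
  maximal_ideal [set f | Spec_set P (coz f)].
Proof.
have [[[U0 PU0] Ple PU] PT PC] := Spec_prime P.
split; first split.
- by rewrite /= coz0; apply: Ple PU0; exact: le0x.
- by move=> f g /= Pf Pg; apply: Ple (cozD f g) _; exact: PU.
- by move=> f g /= Pg; rewrite cozM; apply: Ple Pg; exact: leIr.
- move=> /seteqP[_ /(_ 1 I)] /=; rewrite -charT coz_char; exact: PT.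
move=> J [J0 JD JM] PJ.
have [JP|/existsNP[f /not_implyP[Jf nPf]]] :=
  pselect (J `<=` [set f | Spec_set P (coz f)]).
  by left; apply/seteqP.
right; apply/seteqP; split=> // g _.
have J1 : J 1.
  rewrite -(charC (coz f)); apply: JD.
    by rewrite -mulr_qinv mulrC; exact: JM.
  by apply: PJ; rewrite /= coz_char; case: (PC (coz f)).
by rewrite -[g]mulr1; exact: JM.
Qed.

Definition stone_of_max (m : Max M) : Spec B := MkSpec (stone_of_max_prime m).

Definition max_of_stone (P : Spec B) : Max M := MkMax (max_of_stone_maximal P).

Lemma stone_of_maxK : cancel stone_of_max max_of_stone.
Proof.
move=> m; apply: Max_inj; have [[_ _ mM] _ _] := Max_maximal m.
apply/seteqP; split=> f /= mf.
  by rewrite -[f]mulr_char_coz; exact: mM.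
by rewrite -mulr_qinv mulrC; exact: mM.
Qed.

Lemma max_of_stoneK : cancel max_of_stone stone_of_max.
Proof.
by move=> P; apply: Spec_inj; apply/seteqP; split=> U /=; rewrite coz_char.
Qed.

End MaxSpec.

Theorem corollary2p6 (R : realType) (X : Type) (A : set (set X))
    (hX : [set: X] !=set0) (hA : field_of_sets A)
    (hD : meas_addr_closed R A) (hM : meas_mulr_closed R A) :
  homeomorphic (Max (meas_ring hA hD hM)) (Spec (set_alg hA)).
Proof.
exists (@stone_of_max _ _ _ hA hD hM), (@max_of_stone _ _ _ hA hD hM); split.
- by apply: continuous_to_Spec => U; exact: (open_hull_basic (char _ _ U)).
- by apply: continuous_to_Max => f; exact: (open_stone_basic (coz f)).
- exact: stone_of_maxK.
- exact: max_of_stoneK.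
Qed.
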